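(* Suppose that both $G$ and its complement $\overline{G}$ are connected graphs on $n\geq 5$ vertices. Then for every integer $k$ with $\lceil\frac{n}{2}\rceil\leq k\leq n$, we have $mvx_k(G)+mvx_k(\overline{G})\leq 2n-2$, and this bound is sharp.
   Context: All graphs are simple, finite and undirected. Colorings are arbitrary (not necessarily proper). A tree $T$ that is a subgraph of a vertex-colored graph $H$ is a vertex-monochromatic tree if all internal (non-leaf) vertices of $T$ have the same color. For $S\subseteq V(H)$, a vertex-monochromatic $S$-tree is a vertex-monochromatic tree in $H$ whose vertex set contains $S$. For a connected graph $G$ and an integer $k$ with $2\leq k\leq |V(G)|$, an $MVX_k$-coloring of $G$ is a vertex-coloring of $G$ such that for every set $S$ of $k$ vertices of $G$ there exists a vertex-monochromatic $S$-tree. The $k$-monochromatic vertex-index $mvx_k(G)$ is the maximum number of colors used in an $MVX_k$-coloring of $G$. The bound is called sharp if for each pair $(n,k)$ in the stated range there is a graph $G$ on $n$ vertices, with $G$ and $\overline{G}$ connected, attaining equality. *)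

(* Defs.v *)
From mathcomp Require Import all_boot.

Set Implicit Arguments.
Unset Strict Implicit.
Unset Printing Implicit Defensive.

Record sgraph := SGraph {
  vertex :> finType;
  edge : rel vertex;
  edge_sym : symmetric edge;
  edge_irrefl : irreflexive edge }.

Definition compl_edge (G : sgraph) : rel G :=
  [rel x y | (x != y) && ~~ edge x y].

Lemma compl_edge_sym (G : sgraph) : symmetric (@compl_edge G).
Proof. by move=> x y; rewrite /compl_edge /= [y == x]eq_sym [edge y x]edge_sym. Qed.

Lemma compl_edge_irrefl (G : sgraph) : irreflexive (@compl_edge G).
Proof. by move=> x; rewrite /compl_edge /= eqxx. Qed.

Definition compl_graph (G : sgraph) : sgraph :=
  SGraph (@compl_edge_sym G) (@compl_edge_irrefl G).

Definition connected_graph (G : sgraph) : bool :=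
  [forall x : G, forall y : G, connect (@edge G) x y].

Definition edges (G : sgraph) : {set {set G}} :=
  [set [set x; y] | x in G, y in G & edge x y].

(* A pair (W, F) encodes the subgraph of G with vertex set W and edge set F. *)
Definition is_subgraph (G : sgraph) (W : {set G}) (F : {set {set G}}) : bool :=
  (F \subset edges G) && (cover F \subset W).

Definition adj (G : sgraph) (F : {set {set G}}) : rel G :=
  [rel x y | [set x; y] \in F].

Definition degree (G : sgraph) (F : {set {set G}}) (x : G) : nat :=
  #|[set A in F | x \in A]|.

(* A cycle visits at least 3 vertices, all distinct, hence at most #|G|;
   two-element sequences must be excluded, since any edge traversed back and
   forth satisfies ucycleb. *)
Definition acyclic (G : sgraph) (F : {set {set G}}) : bool :=
  [forall m : 'I_#|G|.+1, forall p : m.-tuple G,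
     (2 < m) ==> ~~ ucycleb (adj F) p].

Definition is_tree (G : sgraph) (W : {set G}) (F : {set {set G}}) : bool :=
  [&& is_subgraph W F, W != set0,
      [forall x in W, forall y in W, connect (adj F) x y] & acyclic F].

Definition internal (G : sgraph) (W : {set G}) (F : {set {set G}}) : {set G} :=
  [set x in W | degree F x != 1].

Definition vertex_monochromatic_tree (G : sgraph) (C : eqType) (c : G -> C)
    (W : {set G}) (F : {set {set G}}) : bool :=
  is_tree W F &&
  [forall x in internal W F, forall y in internal W F, c x == c y].

Definition MVX_coloring (G : sgraph) (k : nat) (C : eqType) (c : G -> C) : bool :=
  [forall S : {set G}, (#|S| == k) ==>
     [exists W : {set G}, exists F : {set {set G}},
        vertex_monochromatic_tree c W F && (S \subset W)]].

(* A coloring uses at most #|G| colors and only the partition into color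
   classes matters, so colors can be taken in 'I_#|G|. *)
Definition mvx (k : nat) (G : sgraph) : nat :=
  \max_(c : {ffun G -> 'I_#|G|} | MVX_coloring k c) #|[set c x | x : G]|.

(* Main.v *)
Require Import Defs.
From mathcomp Require Import all_boot.
From mathcomp Require Import zify.

Set Implicit Arguments.
Unset Strict Implicit.
Unset Printing Implicit Defensive.

(** An MVX_k-coloring with n colors is injective, so every monochromatic tree
has at most one internal vertex and, once it has at least three vertices, is a
star: every set of at most k vertices lies in a closed neighbourhood.  With at
least n - 1 colors, at most one pair u, v of vertices shares a color, so the
trees are stars or double stars with the fixed adjacent centres u, v.  This is
[mvx_full_star] and [mvx_near_full_double_star].

Since mvx_k <= n, a sum above 2n - 2 means that one of the two graphs has value
n and the other at least n - 1.  [star_double_star_exclusive] excludes this for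
a relation e with the star property and its complement h with the double-star
property.  As n <= 2k, the vertices split into a part S of size k containing u
and v and a part of size at most k.  Let a and b be e-centres of the two parts.
Then a is h-adjacent to nothing in S, in particular to neither u nor v; if uv is
an h-edge, a also differs from both, so the double star misses a.  This forces
every small set containing a into an h-star.  An h-centre of such a set
that also contains b can only be a or b, because any other vertex lies in one
of the parts and misses the centre of that part.  Applied to the sets {a, b, x}
(here k >= 3 is used), this makes ab an h-edge whose ends dominate all
vertices.  But then {a, b} has no e-centre.

For sharpness, an edge uv dominating all vertices gives a spanning double star;
giving u and v one color and all other vertices distinct colors shows
mvx_k >= n - 1 ([dominating_edge_mvx]).  The graph [blown_bull n] has such an
edge, and so does its complement, so the upper bound is attained. *)

(** * Closed neighbourhoods in a relation and in its complement *)

Definition clnbhd (T : finType) (e : rel T) (z : T) : {set T} :=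
  [set x | (x == z) || e z x].

Lemma exists_superset_card (T : finType) (A : {set T}) k :
  #|A| <= k <= #|T| -> exists2 S : {set T}, A \subset S & #|S| = k.
Proof.
elim: k => [|k IHk] /andP[leAk lekT].
  by exists A => //; apply/eqP; rewrite -leqn0.
move: leAk; rewrite leq_eqVlt => /orP[/eqP cardA|ltAk]; first by exists A.
have [|S subAS cardS] := IHk; first by rewrite -ltnS ltAk ltnW.
have /set0Pn[x] : ~: S != set0 by rewrite -card_gt0 cardsCs setCK cardS subn_gt0.
rewrite inE => notSx; exists (x |: S); last by rewrite cardsU1 notSx cardS.
exact: subset_trans subAS (subsetUr _ _).
Qed.

(** The combinatorial core of the upper bound.  The vertices are covered by two
sets of size at most k, whose e-centres a and b turn out to be the ends of a
dominating edge of h; no vertex is then e-close to both a and b. *)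
Lemma star_double_star_exclusive (T : finType) (e h : rel T) (k : nat) (u v : T) :
    symmetric e -> (forall x y, h x y = (x != y) && ~~ e x y) ->
    2 < k <= #|T| -> #|T| <= 2 * k ->
    (forall x, exists y, h x y) ->
    (forall S : {set T}, #|S| <= k -> exists z, S \subset clnbhd e z) ->
    (forall S : {set T}, #|S| <= k ->
       (exists z, S \subset clnbhd h z) \/
       h u v /\ S \subset clnbhd h u :|: clnbhd h v) ->
  False.
Proof.
move=> esym hE /andP[k_gt2 lekT] leT2k nisol starE starH.
have hsym : symmetric h by move=> x y; rewrite !hE eq_sym esym.
have card2 (x y : T) : #|[set x; y]| <= 2 by rewrite cards2; case: (x != y).
have [|S] := @exists_superset_card _ [set u; v] k.
  by rewrite lekT andbT (leq_trans (card2 u v)) // ltnW.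
rewrite subUset !sub1set => /andP[Su Sv] cardS.
have [|a /subsetP Sa] := starE S; first by rewrite cardS.
have [|b /subsetP Sb] := starE (~: S); first by rewrite cardsCs setCK cardS; lia.
have nSa x : x \in S -> ~~ h a x.
  by move=> /Sa; rewrite inE hE => /orP[/eqP->|->]; rewrite ?eqxx ?andbF.
have nSb x : x \notin S -> ~~ h b x.
  rewrite -in_setC => /Sb.
  by rewrite inE hE => /orP[/eqP->|->]; rewrite ?eqxx ?andbF.
(* If uv is an h-edge, a is h-close to neither end: it is h-adjacent to nothing
   in S, and being one of u, v would make it h-adjacent to the other. *)
have star_a (A : {set T}) : #|A| <= k -> a \in A -> exists z, A \subset clnbhd h z.
  move=> leAk Aa; have [//|[huv /subsetP/(_ a Aa)]] := starH A leAk.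
  rewrite !inE ![h _ a]hsym (negPf (nSa _ Su)) (negPf (nSa _ Sv)) !orbF.
  case/orP => /eqP eqa; move: huv; rewrite -eqa; first by rewrite (negPf (nSa _ Sv)).
  by rewrite hsym (negPf (nSa _ Su)).
have centre z : a \in clnbhd h z -> b \in clnbhd h z -> (z == a) || (z == b).
  rewrite !inE ![h z _]hsym [a == z]eq_sym [b == z]eq_sym.
  case: (boolP (z \in S)) => Sz; first by rewrite (negPf (nSa _ Sz)) orbF => ->.
  by rewrite (negPf (nSb _ Sz)) orbF => _ ->; rewrite orbT.
(* The h-centre of {a, b, x} is a or b, which yields both claims. *)
have dom x : (x \in clnbhd h a :|: clnbhd h b) && h a b.
  have [||z] := star_a [set a; b; x].
  - rewrite setUC cardsU1; have := card2 a b; case: (_ \notin _) => /=; lia.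
  - by rewrite !inE eqxx.
  rewrite !subUset !sub1set => /andP[/andP[za zb] zx].
  (* If a = b, then a would be isolated in h. *)
  have neqab : b != a.
    apply/eqP=> eqba; have [y hay] := nisol a; case: (boolP (y \in S)) => Sy.
      by rewrite (negPf (nSa _ Sy)) in hay.
    by rewrite -eqba (negPf (nSb _ Sy)) in hay.
  have /orP[/eqP eqz|/eqP eqz] := centre z za zb; rewrite eqz in za zb zx.
    by move: zb; rewrite in_setU zx inE (negPf neqab).
  by move: za; rewrite in_setU zx orbT inE eq_sym (negPf neqab) hsym.
have [|w] := starE [set a; b]; first by rewrite (leq_trans (card2 a b)) // ltnW.
rewrite subUset !sub1set !inE ![e w _]esym => /andP[ea eb].
have /andP[_ hab] := dom a; move: hab; rewrite hE => /andP[neq_ab neab].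
have /andP[+ _] := dom w; rewrite !inE !hE -orbA.
case/or4P => [/eqP eqw|/andP[neq_aw neaw]|/eqP eqw|/andP[neq_bw nebw]].
- by move: eb; rewrite eqw eq_sym (negPf neq_ab) esym (negPf neab).
- by move: ea; rewrite (negPf neq_aw) (negPf neaw).
- by move: ea; rewrite eqw (negPf neq_ab) (negPf neab).
- by move: eb; rewrite (negPf neq_bw) (negPf nebw).
Qed.

(** * Subtrees with few internal vertices *)

Lemma set2_inj (T : finType) (x y z : T) : [set x; y] = [set x; z] -> y = z.
Proof.
move=> eq_xyz; have := set22 x y; rewrite eq_xyz => /set2P[] // eqyx.
by have := set22 x z; rewrite -eq_xyz eqyx => /set2P[].
Qed.

Section Trees.
Variable G : sgraph.
Implicit Types (W : {set G}) (F : {set {set G}}).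

Lemma edges_edge (x y : G) : [set x; y] \in edges G -> edge x y.
Proof.
case/imset2P => a b _; rewrite inE => /andP[_ eab] eq_xy.
have /set2P[eqx|eqx] : x \in [set a; b] by rewrite -eq_xy set21.
  by move: eq_xy; rewrite eqx => /set2_inj->.
by move: eq_xy; rewrite eqx [[set a; b]]setUC => /set2_inj->; rewrite edge_sym.
Qed.

Lemma adj_edge W F x y : is_subgraph W F -> adj F x y -> edge x y.
Proof. by case/andP => /subsetP subFE _ /subFE/edges_edge. Qed.

Lemma adj_sym F : symmetric (adj F).
Proof. by move=> x y; rewrite /adj /= setUC. Qed.

Lemma adj_in W F x y : is_subgraph W F -> adj F x y -> x \in W /\ y \in W.
Proof.
case/andP => _ /subsetP subFW Fxy.
by split; apply: subFW; apply/bigcupP; exists [set x; y]; rewrite ?set21 ?set22.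
Qed.

Lemma leaf_adj W F x : is_subgraph W F -> degree F x = 1 -> exists y, adj F x y.
Proof.
move=> /andP[/subsetP subFE _] /eqP/cards1P[A eqA].
have : A \in [set A in F | x \in A] by rewrite eqA set11.
rewrite inE => /andP[FA]; have /imset2P[a b _ _ defA] := subFE _ FA.
rewrite defA in FA *.
by case/set2P=> ->; [exists b | exists a; rewrite adj_sym].
Qed.

Lemma leaf_adj_uniq F x y z : degree F x = 1 -> adj F x y -> adj F x z -> y = z.
Proof.
move=> /eqP/cards1P[A eqA] Fxy Fxz; apply: (@set2_inj _ x).
have inA B : B \in F -> x \in B -> B = A.
  by move=> FB Bx; apply/set1P; rewrite -eqA inE FB.
by rewrite (inA _ Fxy (set21 x y)) (inA _ Fxz (set21 x z)).
Qed.

(** Connectedness of a tree, in the form used below: a set closed under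
adjacency that meets the tree contains it. *)
Lemma tree_closed_sub W F (B : {set G}) x :
  is_tree W F -> x \in W -> x \in B ->
  (forall y z, adj F y z -> y \in B -> z \in B) -> W \subset B.
Proof.
case/and4P => _ _ /forall_inP conW _ Wx Bx clB; apply/subsetP => y Wy.
have clF : closed (adj F) [in B].
  by move=> s t Fst; apply/idP/idP; apply: clB; rewrite // adj_sym.
by rewrite -[y \in B](closed_connect clF (forall_inP (conW x Wx) y Wy)).
Qed.

Lemma notin_internal W F x : x \in W -> x \notin internal W F -> degree F x = 1.
Proof. by move=> Wx; rewrite inE Wx negbK => /eqP. Qed.

(** Two adjacent leaves form a whole component, so this fails only for the tree
with a single edge. *)
Lemma leaf_adj_internal W F x :
  is_tree W F -> 2 < #|W| -> x \in W -> x \notin internal W F ->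
  exists2 y, y \in internal W F & adj F x y.
Proof.
move=> treeW cardW Wx /(notin_internal Wx) degx.
have subW : is_subgraph W F by case/and4P: treeW.
have [y Fxy] := leaf_adj subW degx; exists y => //.
have [_ Wy] := adj_in subW Fxy.
apply: contraLR cardW => /(notin_internal Wy) degy; rewrite -leqNgt.
have subWxy: W \subset [set x; y].
  apply: (tree_closed_sub treeW Wx (set21 _ _)) => s t Fst /set2P[] eqs.
    by rewrite eqs in Fst; rewrite (leaf_adj_uniq degx Fst Fxy) set22.
  rewrite eqs in Fst.
  by rewrite (leaf_adj_uniq degy Fst (z := x)) ?set21 // adj_sym.
by rewrite (leq_trans (subset_leq_card subWxy)) // cards2; case: (_ != _).
Qed.

(** If u and v were not adjacent, all neighbours of u would be leaves, and the
star around u would be a component that misses v. *)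
Lemma internal_pair_adj W F u v :
  is_tree W F -> internal W F = [set u; v] -> u != v -> edge u v.
Proof.
move=> treeW intW neq_uv; have subW : is_subgraph W F by case/and4P: treeW.
have Wi x : x \in [set u; v] -> x \in W by rewrite -intW inE => /andP[].
have [Wu Wv] : u \in W /\ v \in W by split; apply: Wi; rewrite ?set21 ?set22.
apply: (adj_edge subW); apply: contraNT neq_uv => nFuv.
suff : W \subset [set x | (x == u) || adj F u x].
  by move/subsetP/(_ v Wv); rewrite inE (negPf nFuv) orbF eq_sym.
apply: (tree_closed_sub treeW Wu); first by rewrite inE eqxx.
move=> s t Fst; rewrite !inE => /orP[/eqP<-|Fus]; first by rewrite Fst orbT.
have [_ Ws] := adj_in subW Fus.
have [eqs|neq_su] := eqVneq s u; first by rewrite -eqs Fst orbT.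
have degs : degree F s = 1.
  apply: (notin_internal Ws); rewrite intW !inE negb_or neq_su /=.
  by apply: contraNneq nFuv => <-.
by rewrite (leaf_adj_uniq degs Fst (z := u)) ?eqxx // adj_sym.
Qed.

(** * Colourings with almost as many colours as vertices *)

(** The internal vertices of a monochromatic tree share a color, so they form a
single vertex or the unique colliding pair.  Sets with fewer than k vertices are
covered by enlarging them.  The case u = v expresses that c is injective, and
then only the first alternative is possible. *)
Lemma MVX_near_injective k (C : eqType) (c : G -> C) (u v : G) :
    (forall x y, c x = c y -> x != y -> [set x; y] = [set u; v]) ->
    MVX_coloring k c -> 2 < k <= #|G| ->
  forall S : {set G}, #|S| <= k ->
    (exists z, S \subset clnbhd (@edge G) z) \/
    edge u v /\ S \subset clnbhd (@edge G) u :|: clnbhd (@edge G) v.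
Proof.
move=> c_inj /forallP MVXc /andP[k_gt2 lekG] S0 leS0k.
have [|S subS0S cardS] := @exists_superset_card _ S0 k; first by rewrite leS0k.
have := MVXc S; rewrite cardS eqxx => /existsP[W /existsP[F /andP[/andP[treeW]]]].
move=> /forall_inP monoW subSW.
have subW : is_subgraph W F by case/and4P: treeW.
have subS0W := subset_trans subS0S subSW.
have cardW : 2 < #|W| by rewrite (leq_trans k_gt2) // -cardS subset_leq_card.
have near x : x \in W -> exists2 y, y \in internal W F & x \in clnbhd (@edge G) y.
  move=> Wx; have [ix|nix] := boolP (x \in internal W F).
    by exists x; rewrite // inE eqxx.
  have [y iy Fxy] := leaf_adj_internal treeW cardW Wx nix.
  by exists y; rewrite // inE edge_sym (adj_edge subW Fxy) orbT.
have /set0Pn[x0 Wx0] : W != set0 by rewrite -card_gt0; apply: leq_trans cardW.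
have [z iz _] := near x0 Wx0.
have pair y : y \in internal W F -> y != z -> [set y; z] = [set u; v].
  by move=> iy; apply: c_inj; apply/eqP/(forall_inP (monoW y iy)).
have [subz|] := boolP (internal W F \subset [set z]).
  left; exists z; apply: (subset_trans subS0W); apply/subsetP => x /near[y].
  by move/(subsetP subz)/set1P->.
case/subsetPn => t it; rewrite inE => neq_tz; right.
have eq_tz := pair t it neq_tz.
have intW : internal W F = [set u; v].
  apply/eqP; rewrite eqEsubset; apply/andP; split; apply/subsetP => y.
    have [->|neq_yz iy] := eqVneq y z; first by rewrite -eq_tz set22.
    by rewrite -(pair y iy neq_yz) set21.
  by rewrite -eq_tz => /set2P[]->.
have neq_uv : u != v.
  have := cards2 t z; rewrite eq_tz cards2 neq_tz.
  by case: (u != v).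
split; first exact: internal_pair_adj treeW intW neq_uv.
apply: (subset_trans subS0W); apply/subsetP => x /near[y].
by rewrite intW => /set2P[]-> near_x; rewrite in_setU near_x ?orbT.
Qed.

(** Given a collision c u = c v, no color is lost by deleting v, so the
n - 1 remaining vertices already need n - 1 colors and c is injective on
them. *)
Lemma collisions_pair (C : finType) (c : G -> C) :
  0 < #|G| -> #|G|.-1 <= #|[set c x | x : G]| ->
  exists u v, forall x y, c x = c y -> x != y -> [set x; y] = [set u; v].
Proof.
case/card_gt0P => x0 _ many.
have [/injectiveP c_inj|/injectivePn[u [v neq_uv eq_c]]] := boolP (injectiveb c).
  by exists x0, x0 => x y /c_inj->; rewrite eqxx.
exists u, v.
have imE : [set c x | x : G] = c @: [set~ v].
  apply/setP=> i; apply/imsetP/imsetP => [[x _ ->]|[x _ ->]]; last by exists x.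
  have [->|neq_xv] := eqVneq x v; last by exists x; rewrite // !inE.
  by exists u; rewrite ?eq_c // !inE.
have inj_v : {in [set~ v] &, injective c}.
  apply/imset_injP; rewrite eqn_leq leq_imset_card -imE.
  by rewrite (leq_trans _ many) // cardsC1.
have collide y : c y = c v -> y != v -> y = u.
  by rewrite -eq_c => eq_y neq_yv; apply: inj_v; rewrite ?inE.
move=> x y eq_xy neq_xy; have [eqx|neq_xv] := eqVneq x v.
  by rewrite setUC (collide y) -?eqx // eq_sym.
have [eqy|neq_yv] := eqVneq y v; first by rewrite (collide x) -?eqy.
by rewrite (inj_v x y) ?inE ?eqxx in neq_xy.
Qed.

Lemma mvx_witness k m : 0 < m <= mvx k G ->
  exists2 c : {ffun G -> 'I_#|G|}, MVX_coloring k c & m <= #|[set c x | x : G]|.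
Proof.
case/andP => m_gt0 le_m; apply/exists_inP; apply: contraLR le_m => /exists_inPn no_c.
rewrite -ltnNge -(prednK m_gt0) ltnS; apply/bigmax_leqP => c MVXc.
by rewrite -ltnS prednK // ltnNge; apply: no_c.
Qed.

Lemma mvx_leq_card k : mvx k G <= #|G|.
Proof. by apply/bigmax_leqP => c _; apply: leq_imset_card. Qed.

Lemma mvx_full_star k : 2 < k <= #|G| -> mvx k G = #|G| ->
  forall S : {set G}, #|S| <= k -> exists z, S \subset clnbhd (@edge G) z.
Proof.
move=> kG mvxG S leSk; have G_gt0 : 0 < #|G| by lia.
have [|c MVXc card_c] := @mvx_witness k #|G|; first by rewrite mvxG G_gt0 /=.
have /imset_injP c_inj : #|c @: G| == #|G| by rewrite eqn_leq leq_imset_card.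
have /card_gt0P[u _] := G_gt0.
have [|//|] := MVX_near_injective (u := u) (v := u) _ MVXc kG leSk; last first.
  by rewrite edge_irrefl => -[].
by move=> x y /c_inj-> //; rewrite eqxx.
Qed.

Lemma mvx_near_full_double_star k : 2 < k <= #|G| -> #|G|.-1 <= mvx k G ->
  exists u v, forall S : {set G}, #|S| <= k ->
    (exists z, S \subset clnbhd (@edge G) z) \/
    edge u v /\ S \subset clnbhd (@edge G) u :|: clnbhd (@edge G) v.
Proof.
move=> kG mvxG; have [|c MVXc card_c] := @mvx_witness k #|G|.-1; first by lia.
have [|u [v c_inj]] := collisions_pair _ card_c; first by lia.
by exists u, v => S; apply: (MVX_near_injective c_inj MVXc).
Qed.

Lemma connected_no_isolated (x : G) :
  connected_graph G -> 1 < #|G| -> exists y, edge x y.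
Proof.
move=> /forallP/(_ x)/forallP conG /card_gt1P[a [b [_ _ neq_ab]]].
have [y neq_xy] : exists y, x != y.
  by case: (eqVneq x a) => [->|]; [exists b | exists a].
have /connectP[[|z p] /= pth lst] := conG y; first by rewrite lst eqxx in neq_xy.
by exists z; case/andP: pth.
Qed.

(** * Graphs with a dominating edge *)

Lemma dominating_edge_connected (u v : G) :
  edge u v -> (forall x, x \in clnbhd (@edge G) u :|: clnbhd (@edge G) v) ->
  connected_graph G.
Proof.
move=> uv dom.
have con x : connect (@edge G) u x.
  have := dom x; rewrite !inE -orbA => /or4P[/eqP->|ux|/eqP->|vx] //.
  - exact: connect1.
  - exact: connect1.
  exact: connect_trans (connect1 uv) (connect1 vx).
apply/forallP=> x; apply/forallP=> y; apply: connect_trans (con y).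
by rewrite (sym_connect_sym (@edge_sym G)).
Qed.

Section DominatingEdge.
Variables u v : G.
Hypothesis uv : edge u v.
Hypothesis dom : forall x, x \in clnbhd (@edge G) u :|: clnbhd (@edge G) v.

(** The parent of x in the double star rooted at u; since uv is an edge, v has
parent u. *)
Definition centre x := if edge u x then u else v.
Definition double_star : {set {set G}} :=
  [set [set x; centre x] | x in [set~ u]].

Lemma edge_centre x : x != u -> edge x (centre x).
Proof.
rewrite /centre edge_sym => neq_xu; case: ifP => // nux.
have := dom x; rewrite !inE (negPf neq_xu) nux /= => /orP[/eqP eqx|//].
by rewrite eqx uv in nux.
Qed.

Lemma double_star_adj_centre x : x != u -> adj double_star x (centre x).
Proof. by move=> neq_xu; apply/imsetP; exists x; rewrite ?inE. Qed.

Lemma double_star_leaf A x : x \notin [set u; v] -> A \in double_star -> x \in A ->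
  A = [set x; centre x].
Proof.
move=> nx /imsetP[w _ ->] /set2P[-> //|eqx].
by move: nx; rewrite eqx /centre; case: ifP; rewrite !inE eqxx ?orbT.
Qed.

Lemma double_star_tree : is_tree [set: G] double_star.
Proof.
apply/and4P; split.
- apply/andP; split; last exact: subsetT.
  apply/subsetP => A /imsetP[x]; rewrite !inE => neq_xu ->.
  by apply: imset2_f; rewrite // inE edge_centre.
- by apply/set0Pn; exists u.
- have con x : connect (adj double_star) u x.
    have uCv : connect (adj double_star) u v.
      apply: connect1; rewrite adj_sym.
      have := @double_star_adj_centre v; rewrite /centre uv; apply.
      by apply: contraTneq uv => ->; rewrite edge_irrefl.
    have [->//|/double_star_adj_centre] := eqVneq x u.
    rewrite adj_sym /centre; case: ifP => _ adjx; first exact: connect1.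
    exact: connect_trans uCv (connect1 adjx).
  apply/forall_inP=> x _; apply/forall_inP=> y _; apply: connect_trans (con y).
  by rewrite (sym_connect_sym (@adj_sym _)).
apply/forallP=> m; apply/forallP=> p; apply/implyP=> m_gt2.
apply/negP=> /andP[cyc uniq_p].
have [x px nx] : exists2 x, x \in p & x \notin [set u; v].
  apply/exists_inP; apply: contraLR m_gt2 => /exists_inPn sub_uv.
  rewrite -leqNgt -[X in X <= _](size_tuple p).
  have : {subset p <= [:: u; v]} by move=> x /sub_uv; rewrite negbK !inE.
  exact: uniq_leq_size.
(* Rotated to start at x, the cycle would leave x and return to it through two
   distinct neighbours, but the leaf x has only one. *)
have [i s rot_p] := rot_to px.
have : cycle (adj double_star) (x :: s) by rewrite -rot_p rot_cycle.
have : uniq (x :: s) by rewrite -rot_p rot_uniq.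
have : size (x :: s) = m by rewrite -rot_p size_rot size_tuple.
case: s {rot_p} => [|y s] /= sz; first by rewrite -sz in m_gt2.
have only t : adj double_star x t -> t = centre x.
  by move/double_star_leaf=> /(_ x nx (set21 _ _))/set2_inj.
rewrite rcons_path => /and3P[_ ny _] /and3P[/only eqy _]; rewrite adj_sym => /only eql.
case: s ny sz eql => [|z s] ny sz eql; first by rewrite -sz in m_gt2.
by move: ny; rewrite eqy -eql /= mem_last.
Qed.

(** The spanning double star is one monochromatic tree that serves all sets S,
which is why the bound holds for every k. *)
Lemma dominating_edge_mvx k : #|G|.-1 <= mvx k G.
Proof.
pose c : {ffun G -> 'I_#|G|} := [ffun x => enum_rank (if x == v then u else x)].
have MVXc : MVX_coloring k c.
  apply/forallP=> S; apply/implyP=> _.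
  apply/existsP; exists setT; apply/existsP; exists double_star.
  rewrite subsetT andbT /vertex_monochromatic_tree double_star_tree /=.
  have c_int x : x \in internal setT double_star -> c x = enum_rank u.
    rewrite inE ffunE => /andP[_ degx]; congr enum_rank.
    apply: contraNeq degx => neq_x; apply/cards1P; exists [set x; centre x].
    have nx : x \notin [set u; v].
      by move: neq_x; rewrite !inE; case: (x == v); rewrite ?eqxx ?orbF.
    apply/setP=> A; rewrite !inE; apply/andP/eqP => [[FA Ax]|->].
      exact: double_star_leaf.
    rewrite set21; split=> //; apply: double_star_adj_centre.
    by apply: contraNneq nx => ->; rewrite set21.
  by apply/forall_inP=> x /c_int->; apply/forall_inP=> y /c_int->.
apply: leq_trans (leq_bigmax_cond _ MVXc).
have inj_v : {in [set~ v] &, injective c}.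
  by move=> x y; rewrite !inE !ffunE => /negPf-> /negPf-> /enum_rank_inj.
rewrite -(cardsC1 v) -(card_in_imset inj_v) subset_leq_card // imsetS //.
exact: subset_predT.
Qed.
End DominatingEdge.
End Trees.

(** * The upper bound *)

Lemma mvx_compl_upper (n k : nat) (G : sgraph) :
    5 <= n -> uphalf n <= k <= n -> #|G| = n ->
    connected_graph G -> connected_graph (compl_graph G) ->
  mvx k G + mvx k (compl_graph G) <= 2 * n - 2.
Proof.
move=> n5 /andP[lenk lekn] cardG conG conH.
have cardH : #|compl_graph G| = n by [].
have kG : 2 < k <= #|G| by lia.
have kH : 2 < k <= #|compl_graph G| by rewrite cardH -cardG.
have leG := mvx_leq_card G k; have leH := mvx_leq_card (compl_graph G) k.
rewrite cardH in leH; rewrite cardG in leG.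
have [lt_sum|//] := ltnP; exfalso.
have symH := @compl_edge_sym G.
(* The complement of the complement is G, so the same argument applies with the
   two graphs exchanged. *)
have GE x y : edge x y = (x != y) && ~~ @compl_edge G x y.
  by rewrite /compl_edge /=; case: eqVneq => [->|]; rewrite ?edge_irrefl ?negbK.
have [mvxG|ltG] : mvx k G = n \/ mvx k G < n by lia.
  have [||u [v HS]] := @mvx_near_full_double_star (compl_graph G) k;
    rewrite ?cardH //; try lia.
  apply: (star_double_star_exclusive (e := @edge G) (h := @compl_edge G)
           (k := k) (u := u) (v := v) (@edge_sym G)) => //; try lia.
  - by move=> x; apply: (@connected_no_isolated (compl_graph G) x conH); lia.
  - by apply: mvx_full_star; rewrite // mvxG.
have [||u [v HS]] := @mvx_near_full_double_star G k; rewrite ?cardG //; try lia.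
apply: (star_double_star_exclusive (e := @compl_edge G) (h := @edge G)
           (k := k) (u := u) (v := v) symH) => //; try lia.
- by move=> x; apply: (connected_no_isolated x conG); lia.
- by apply: (@mvx_full_star (compl_graph G) k kH); lia.
Qed.

(** * A graph attaining the bound *)

(** The path 0 - 1 - 2 - 3 together with vertices 4, ..., n - 1 joined exactly
to 1 and 2.  For n = 5 this is the bull, which is self-complementary; the extra
vertices blow up its nose.  The edge 12 is dominating here, and 03 is in the
complement. *)
Definition blown_bull_edge n : rel 'I_n := [rel x y : 'I_n | (x != y) &&
  [|| (x == 1 :> nat) && (y != 3 :> nat),
      (y == 1 :> nat) && (x != 3 :> nat),
      (x == 2 :> nat) && (y != 0 :> nat) |
      (y == 2 :> nat) && (x != 0 :> nat)]].

Lemma blown_bull_edge_sym n : symmetric (@blown_bull_edge n).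
Proof. by move=> x y; rewrite /blown_bull_edge /= -!val_eqE /=; lia. Qed.

Lemma blown_bull_edge_irrefl n : irreflexive (@blown_bull_edge n).
Proof. by move=> x; rewrite /blown_bull_edge /= eqxx. Qed.

Definition blown_bull n : sgraph :=
  SGraph (@blown_bull_edge_sym n) (@blown_bull_edge_irrefl n).

Lemma blown_bull_dominating_edge n : 5 <= n -> exists u v : blown_bull n,
  edge u v /\ forall x, x \in clnbhd (@edge (blown_bull n)) u
                       :|: clnbhd (@edge (blown_bull n)) v.
Proof.
move=> n5; have [n1 n2] : 1 < n /\ 2 < n by lia.
exists (Ordinal n1), (Ordinal n2); split=> [//|x].
by rewrite !inE /= /blown_bull_edge /= -!val_eqE /=; lia.
Qed.

Lemma blown_bull_compl_dominating_edge n : 5 <= n ->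
  exists u v : compl_graph (blown_bull n),
  edge u v /\ forall x, x \in clnbhd (@edge (compl_graph (blown_bull n))) u
                       :|: clnbhd (@edge (compl_graph (blown_bull n))) v.
Proof.
move=> n5; have [n0 n3] : 0 < n /\ 3 < n by lia.
exists (Ordinal n0), (Ordinal n3); split=> [//|x].
by rewrite !inE /= /compl_edge /= /blown_bull_edge /= -!val_eqE /=; lia.
Qed.

Theorem theorem4p7 (n k : nat) (hn : 5 <= n) (hk : uphalf n <= k <= n) :
  (forall G : sgraph, #|G| = n ->
     connected_graph G -> connected_graph (compl_graph G) ->
     mvx k G + mvx k (compl_graph G) <= 2 * n - 2)
  /\ (exists G : sgraph,
        [/\ #|G| = n, connected_graph G, connected_graph (compl_graph G)
          & mvx k G + mvx k (compl_graph G) = 2 * n - 2]).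
Proof.
have upper G := @mvx_compl_upper n k G hn hk; split; first exact: upper.
have [u [v [uv dom]]] := blown_bull_dominating_edge hn.
have [u' [v' [uv' dom']]] := blown_bull_compl_dominating_edge hn.
have conG := dominating_edge_connected uv dom.
have conH := dominating_edge_connected uv' dom'.
have cardG : #|blown_bull n| = n by rewrite card_ord.
exists (blown_bull n); split => //.
have := upper _ cardG conG conH.
have := dominating_edge_mvx uv dom k; have := dominating_edge_mvx uv' dom' k.
rewrite cardG; lia.
Qed.
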